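(* Let $s\ge 2$, $1\le d\le s$ and $1\le r\le\binom{s}{d}$ be integers with $2d+r-2<s$. Then $$d_r(C_d)=(q-2)^{d-1}(q-1)^{s-d-r+1}\left[(q-1)^r-1\right].$$
   Context: $K=\mathbb{F}_q$ is the finite field with $q$ elements, $q$ a power of a prime, and $S=K[t_1,\dots,t_s]$. $KV_d$ is the $K$-span of the square-free monomials of degree $d$ in $S$, i.e. monomials $t_1^{a_1}\cdots t_s^{a_s}$ with all $a_i\in\{0,1\}$ and $\sum a_i=d$. $T=(\mathbb{F}_q^* )^s=\{P_1,\dots,P_m\}$, $m=(q-1)^s$, is the affine torus. The affine toric code $C_d$ (over the $d$-th hypersimplex) is the image of $KV_d\to\mathbb{F}_q^m$, $f\mapsto(f(P_1),\dots,f(P_m))$. $V_T(H)$ denotes the set of common zeros in $T$ of the polynomials in $H$. For $1\le r\le\dim_K KV_d$, the $r$-th generalized Hamming weight of $C_d$ is $$d_r(C_d):=\min\{|T\setminus V_T(H)| : H=\{f_1,\dots,f_r\}\subseteq KV_d \text{ linearly independent over } K\}.$$ (For $q\ge3$ this is the usual $r$-th generalized Hamming weight, i.e. the minimum support size of an $r$-dimensional subcode.) *)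

(* Defs.v *)
From HB Require Import structures.
From mathcomp Require Import all_boot all_order all_algebra.
From mathcomp Require Import mpoly.

Set Implicit Arguments.
Unset Strict Implicit.
Unset Printing Implicit Defensive.

Import GRing.Theory.

Local Open Scope ring_scope.

Definition sqfree_mnm (s : nat) (m : 'X_{1..s}) : bool :=
  [forall i : 'I_s, (m i <= 1)%N].

(* The bound [< d.+1] on the degree only serves to make the index type finite:
   this is the sum over all square-free monomials of degree exactly d. *)
Definition inKV (K : finFieldType) (s d : nat) (f : {mpoly K[s]}) : Prop :=
  exists c : 'X_{1..s < d.+1} -> K,
    f = \sum_(m : 'X_{1..s < d.+1} | sqfree_mnm m && (mdeg m == d))
          c m *: 'X_[m].

Definition lin_indep (K : finFieldType) (s r : nat)
    (H : 'I_r -> {mpoly K[s]}) : Prop :=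
  forall c : 'I_r -> K, \sum_(i < r) c i *: H i = 0 -> forall i, c i = 0.

Definition torus (K : finFieldType) (s : nat) : {set {ffun 'I_s -> K}} :=
  [set x : {ffun 'I_s -> K} | [forall i, x i != 0]].

Definition VT (K : finFieldType) (s r : nat) (H : 'I_r -> {mpoly K[s]}) :
    {set {ffun 'I_s -> K}} :=
  [set x in torus K s | [forall i, (H i).@[x] == 0]].

(* [is_ghw K s d r w] says d_r(C_d) = w, i.e. that w is the minimum of
   |T \ V_T(H)| over the linearly independent families H of r elements of
   KV_d. *)
Definition is_ghw (K : finFieldType) (s d r w : nat) : Prop :=
  (exists H : 'I_r -> {mpoly K[s]},
     [/\ forall i, inKV d (H i), lin_indep H
       & #|torus K s :\: VT H| = w])
  /\ (forall H : 'I_r -> {mpoly K[s]},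
        (forall i, inKV d (H i)) -> lin_indep H ->
        (w <= #|torus K s :\: VT H|)%N).

(* Main.v *)
Require Import Defs.
From mathcomp Require Import all_boot all_order all_algebra all_field.
From mathcomp Require Import mpoly zify.

(* Lower bound: H spans a space with r distinct leading monomials, each the
   squarefree monomial of a d-set A_j. Multiplying by monomials, every monomial
   m with exponents at most q - 2 that is divisible by some A_j is the leading
   monomial of a polynomial vanishing on V_T(H). By the Combinatorial
   Nullstellensatz no nonzero combination of these vanishes on T, so
   |T \ V_T(H)| is at least the number of such m. Those divisible by A_j but by
   no earlier A_i include all that avoid one chosen element of each A_i \ A_j,
   which gives at least (q-2)^d (q-1)^(s-d-j) of them (j = 0, ..., r-1).

   Upper bound: the forms
   (t_0 - t_e) ... (t_(e-1) - t_(2e-1)) (t_(2e+j) - t_(2e)), 1 <= j <= r, with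
   e = d - 1, attain this number. *)

Set Implicit Arguments.
Unset Strict Implicit.
Unset Printing Implicit Defensive.

Import GRing.Theory.
Local Open Scope ring_scope.

(** * Power sums over a finite field, and polynomials vanishing on the torus *)

Lemma natr_card_finField (K : finFieldType) : #|K|%:R = 0 :> K.
Proof.
have : \sum_(x : K) x = \sum_(x : K) (x + 1) by exact: reindex_inj (addIr 1).
rewrite big_split /= sumr_const.
by rewrite -[in LHS](addr0 (\sum_x x)) => /addrI.
Qed.

Lemma card_finField_gt1 (K : finFieldType) : (1 < #|K|)%N.
Proof. by apply/card_gt1P; exists 0, 1; split=> //; rewrite eq_sym oner_eq0. Qed.

Lemma card_finField_neq0 (K : finFieldType) :
  #|[pred x : K | x != 0]| = #|K|.-1.
Proof.
rewrite -(cardC1 (0 : K)); apply: eq_card => x; by rewrite !inE.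
Qed.

(** If q - 1 divides k, all q - 1 terms are 1 and q = 0 in [K]. Otherwise some g has g^k != 1, and
    substituting g x for x multiplies the sum by g^k, so it is 0. *)
Lemma sum_neq0_expf (K : finFieldType) k :
  \sum_(x : K | x != 0) x ^+ k = if (#|K|.-1 %| k)%N then -1 else 0 :> K.
Proof.
have K1 := card_finField_gt1 K.
have expK1 (x : K) : x != 0 -> x ^+ #|K|.-1 = 1.
  move=> x0; apply: (mulfI x0); rewrite mulr1 -exprS prednK ?expf_card //.
  exact: ltnW.
case: ifP => [/dvdnP[e ->]|ndvd].
  rewrite (eq_bigr (fun=> 1)) => [|x x0]; last first.
    by rewrite mulnC exprM expK1 // expr1n.
  rewrite sumr_const card_finField_neq0; apply/eqP; rewrite -addr_eq0.
  by rewrite natr1 prednK ?natr_card_finField // ltnW.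
(* Without such a g, the q - 1 nonzero elements would all be roots of X^l - 1, where l = k mod (q -
   1) is positive and less than q - 1. *)
have [g g0 gk] : exists2 g : K, g != 0 & g ^+ k != 1.
  suff /existsP[g /andP[]] : [exists g : K, (g != 0) && (g ^+ k != 1)] by exists g.
  apply: contraFT ndvd; rewrite negb_exists => /forallP allk.
  rewrite /dvdn; case: posnP => // k_gt0.
  have /max_unity_roots/(_ _ (enum_uniq [pred x : K | x != 0])) := k_gt0.
  rewrite -cardE card_finField_neq0 => le_k.
  suff /le_k : all (k %% #|K|.-1).-unity_root (enum [pred x : K | x != 0]).
    by rewrite leqNgt ltn_mod -subn1 subn_gt0 K1.
  apply/allP=> x; rewrite mem_enum inE => x0; apply/unity_rootP.
  have := allk x; rewrite x0 negbK => /eqP.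
  by rewrite {1}(divn_eq k #|K|.-1) exprD mulnC exprM expK1 // expr1n mul1r.
set S := (X in X = 0).
have : S = g ^+ k * S.
  rewrite {1}/S (reindex_inj (mulfI g0)) /= mulr_sumr.
  by apply: eq_big => [x|x _]; rewrite ?mulf_eq0 ?(negPf g0) // exprMn.
move/eqP; rewrite -subr_eq0 -{1}[S]mul1r -mulrBl mulf_eq0 subr_eq0 eq_sym.
by rewrite (negPf gk) => /eqP.
Qed.

(* Combinatorial Nullstellensatz on the torus: the coefficient of [m] is, up to
   sign, the sum of [p x * x ^ (#|K| - 1 - m)] over the torus. *)
Lemma torus_nullstellensatz (K : finFieldType) (s : nat) (p : {mpoly K[s]})
    (m : 'X_{1..s}) :
    (forall i, m i < #|K|.-1)%N ->
    (forall m', m' \in msupp p -> mdeg m' <= mdeg m)%N ->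
    (forall x, x \in torus K s -> p.@[x] = 0) ->
  p@_m = 0.
Proof.
move=> m_lt m_max p0; pose e (m' : 'X_{1..s}) i := (m' i + (#|K|.-1 - m i))%N.
have torusE (x : {ffun 'I_s -> K}) :
    (x \in torus K s) = (x \in ffun_on [pred y : K | y != 0]).
  by rewrite inE; apply/forallP/ffun_onP.
have sumE m' : \sum_(x in torus K s) \prod_i x i ^+ e m' i =
    \prod_i (if (#|K|.-1 %| e m' i)%N then -1 else 0).
  rewrite (eq_bigl _ _ torusE) -(bigA_distr_big _ (fun i y => y ^+ e m' i)).
  by apply: eq_bigr => i _; rewrite -sum_neq0_expf.
have : \sum_(x in torus K s) p.@[x] * \prod_i x i ^+ (#|K|.-1 - m i) = 0.
  by rewrite big1 // => x /p0 ->; rewrite mul0r.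
under eq_bigr => x _ do rewrite mevalE mulr_suml.
rewrite exchange_big /=.
have sum1 m' : \sum_(x in torus K s)
      p@_m' * \prod_i x i ^+ m' i * \prod_i x i ^+ (#|K|.-1 - m i) =
    p@_m' * \prod_i (if (#|K|.-1 %| e m' i)%N then -1 else 0).
  rewrite -sumE mulr_sumr; apply: eq_bigr => x _; rewrite -mulrA -big_split /=.
  by congr (_ * _); apply: eq_bigr => i _; rewrite -exprD.
under eq_bigr => m' _ do rewrite sum1.
have [m_in|/memN_msupp_eq0 //] := boolP (m \in msupp p).
rewrite (bigD1_seq m) ?msupp_uniq //= [X in _ + X]big1_seq ?addr0.
  move/eqP; rewrite mulf_eq0 => /orP[/eqP //|].
  rewrite prodf_seq_eq0 => /hasP[i _ /=].
  by rewrite /e subnKC 1?ltnW // dvdnn oppr_eq0 oner_eq0.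
move=> m' /andP[m'm m'_in].
(* If m' dominates m in every coordinate, the degree bound forces m' = m. Otherwise some m' i < m i,
   so 0 < [e m' i] < q - 1 and the i-th power sum is 0. *)
have [/forallP le_m|] := boolP [forall i, m i <= m' i]%N.
  case/eqP: m'm; apply/mnmP => i; have := m_max _ m'_in; rewrite !mdegE.
  rewrite (bigD1 i) //= [leqRHS](bigD1 i) //=.
  move=> le_deg; apply/eqP; rewrite eqn_leq le_m andbT.
  rewrite -(leq_add2r (\sum_(j | j != i) m j)) (leq_trans _ le_deg) //.
  by rewrite leq_add2l; apply: leq_sum => j _; apply: le_m.
rewrite negb_forall => /existsP[i]; rewrite -ltnNge => lt_i.
rewrite (bigD1 i) //= [X in if X then _ else _]gtnNdvd ?mul0r ?mulr0 // /e.
  by rewrite addn_gt0 orbC subn_gt0 m_lt.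
by rewrite -[ltnRHS](subnKC (ltnW (m_lt i))) ltn_add2r.
Qed.

(** * Distinct leading monomials bound the number of points from below *)

Lemma linear_dependence (K : fieldType) (I J : finType) (D : {set I})
    (Z : {set J}) (F : I -> J -> K) :
    (#|Z| < #|D|)%N ->
  exists2 c : {ffun I -> K}, (exists2 i, i \in D & c i != 0)
    & forall z, z \in Z -> \sum_(i in D) c i * F i z = 0.
Proof.
move=> ltZD; pose M := \matrix_(i < #|D|, j < #|Z|) F (enum_val i) (enum_val j).
have : kermx M != 0.
  by rewrite kermx_eq0 -row_leq_rank -ltnNge (leq_ltn_trans (rank_leq_col M)).
case/rowV0Pn=> v /sub_kermxP vM v0.
have [k vk] : exists k, v 0 k != 0.
  apply/existsP; apply: contraNT v0; rewrite negb_exists => /forallP v0.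
  by apply/eqP/rowP=> k; rewrite mxE; apply/eqP; have := v0 k; rewrite negbK.
(* Outside [D] the rank is a default, so [c] is arbitrary there; only sums over [D] matter. *)
pose c i := v 0 (enum_rank_in (enum_valP k) i).
have cE k' : c (enum_val k') = v 0 k' by rewrite /c enum_valK_in.
exists (finfun c); first by exists (enum_val k); rewrite ?enum_valP // ffunE cE.
move=> z zZ; have := congr1 (fun A : 'rV_ _ => A 0 (enum_rank_in zZ z)) vM.
rewrite !mxE => sum0; rewrite big_enum_val -[RHS]sum0; apply: eq_bigr => i _.
by rewrite ffunE cE mxE enum_rankK_in.
Qed.

(** If [Z] were smaller than [D], a nontrivial combination of the [P i] would vanish on [Z], hence
    on the torus. The Nullstellensatz would then kill its leading coefficient, which survives
    because the leading monomials are distinct. *)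
Lemma card_mlead_le (K : finFieldType) (s : nat) (I : finType) (D : {set I})
    (P : I -> {mpoly K[s]}) (Z : {set {ffun 'I_s -> K}}) :
    {in D, forall i, P i != 0} ->
    {in D &, injective (fun i => mlead (P i))} ->
    {in D, forall i j, mlead (P i) j < #|K|.-1}%N ->
    {in D, forall i x, x \in torus K s -> x \notin Z -> (P i).@[x] = 0} ->
  (#|D| <= #|Z|)%N.
Proof.
move=> P0 P_inj P_lt P_van; rewrite leqNgt; apply/negP => lt_ZD.
have [c [i1 i1D ci1] c_van] := linear_dependence (fun i (x : {ffun _}) => (P i).@[x]) lt_ZD.
pose C i := (i \in D) && (c i != 0).
have C1 : C i1 by apply/andP.
case: (Order.TotalTheory.arg_maxP (fun i => mlead (P i)) C1) => i0 /andP[i0D ci0] max_i0.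
pose q := \sum_(i in D) c i *: P i.
have qE m : q@_m = \sum_(i in D) c i * (P i)@_m.
  by rewrite raddf_sum /=; apply: eq_bigr => i _; rewrite mcoeffZ.
have : q@_(mlead (P i0)) = 0.
  apply: torus_nullstellensatz => [j|m|x xT]; first exact: P_lt.
  (* The monomial order refines the degree, so the greatest leading monomial also has maximal
     degree. *)
  - rewrite mcoeff_msupp => qm; apply: lemc_mdeg.
    rewrite Order.TotalTheory.leNgt; apply: contraNN qm => lt_m.
    rewrite qE big1 // => i iD; have [->|ci] := eqVneq (c i) 0; first by rewrite mul0r.
    rewrite mcoeff_gt_mlead ?mulr0 //; apply: Order.POrderTheory.le_lt_trans lt_m.
    by apply: max_i0; apply/andP.
  - rewrite raddf_sum /=; under eq_bigr do rewrite mevalZ.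
    have [/c_van //|xZ] := boolP (x \in Z).
    by rewrite big1 // => i iD; rewrite P_van ?mulr0.
rewrite qE (bigD1 i0) //= big1 ?addr0 => [/eqP|i /andP[iD ne_i]].
  by rewrite mulf_eq0 (negPf ci0) mleadc_eq0 (negPf (P0 _ i0D)).
have [->|ci] := eqVneq (c i) 0; first by rewrite mul0r.
have le_i : (mlead (P i) <= mlead (P i0))%O by apply: max_i0; apply/andP.
rewrite mcoeff_gt_mlead ?mulr0 // Order.POrderTheory.lt_neqAle le_i andbT.
by apply: contra_neq ne_i; apply: P_inj.
Qed.

(** * Leading monomials of a subspace of KV_d *)

Lemma inKV_msupp (K : finFieldType) (s d : nat) (f : {mpoly K[s]}) m :
  inKV d f -> m \in msupp f -> sqfree_mnm m /\ mdeg m = d.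
Proof.
case=> c ->; rewrite mcoeff_msupp raddf_sum /=.
have [/andP[sq_m /eqP dm] _ //|bad] := boolP (sqfree_mnm m && (mdeg m == d)).
rewrite big1 ?eqxx // => m' m'_ok; rewrite mcoeffZ mcoeffX.
have [eqm|_] := eqVneq (bmnm m') m; last by rewrite mulr0.
by rewrite -eqm m'_ok in bad.
Qed.

(** Coefficient vectors are finite functions, so that quantifying over them is boolean. *)
Definition lincomb (K : finFieldType) (s r : nat) (H : 'I_r -> {mpoly K[s]})
  (c : {ffun 'I_r -> K}) := \sum_i c i *: H i.

Lemma msupp_lincomb (K : finFieldType) (s d r : nat) (H : 'I_r -> {mpoly K[s]})
    c m :
    (forall i, inKV d (H i)) -> m \in msupp (lincomb H c) ->
  sqfree_mnm m /\ mdeg m = d.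
Proof.
move=> HKV; rewrite mcoeff_msupp raddf_sum /= => sum_neq0.
have [i mi] : exists i, m \in msupp (H i).
  apply/existsP; apply: contraNT sum_neq0; rewrite negb_exists => /forallP noH.
  by rewrite big1 // => i _; rewrite mcoeffZ memN_msupp_eq0 ?mulr0.
exact: inKV_msupp (HKV i) mi.
Qed.

(** Counting replaces Gaussian elimination. If the set [L] of leading monomials of nonzero
    combinations had fewer than r elements, some nontrivial combination would have coefficient 0 at
    all of them, its own leading monomial included. *)
Lemma exists_mleads (K : finFieldType) (s d r : nat) (H : 'I_r -> {mpoly K[s]}) :
    (forall i, inKV d (H i)) -> lin_indep H ->
  exists c : 'I_r -> {ffun 'I_r -> K},
    [/\ forall j, lincomb H (c j) != 0
      & injective (fun j => mlead (lincomb H (c j)))].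
Proof.
move=> HKV Hfree.
pose is_lead (m : 'X_{1..s < d.+1}) (c : {ffun 'I_r -> K}) :=
  (lincomb H c != 0) && (mlead (lincomb H c) == m).
pose L := [set m | [exists c, is_lead m c]].
have r_le : (r <= #|L|)%N.
  rewrite leqNgt; apply/negP=> lt_L.
  have : (#|L| < #|[set: 'I_r]|)%N by rewrite cardsT card_ord.
  case/(linear_dependence (fun i (m : 'X_{1..s < d.+1}) => (H i)@_m)).
  move=> c [i _ ci] c_van.
  have nz : lincomb H c != 0.
    apply: contra_neq ci => Hc; apply: (Hfree c _ i); exact: Hc.
  have lt_d : (mdeg (mlead (lincomb H c)) < d.+1)%N.
    by have [_ ->] := msupp_lincomb HKV (mlead_supp nz).
  have /c_van : BMultinom lt_d \in L.
    by rewrite inE; apply/existsP; exists c; rewrite /is_lead nz /=.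
  rewrite (eq_bigl predT) => [|j]; last by rewrite inE.
  move=> sum0; case/negP: nz; rewrite -mleadc_eq0 {1}/lincomb raddf_sum /=.
  by apply/eqP; rewrite -[RHS]sum0; apply: eq_bigr => j _; rewrite mcoeffZ.
have exc (j : 'I_r) : exists c, is_lead (enum_val (widen_ord r_le j)) c.
  by have := enum_valP (widen_ord r_le j); rewrite inE => /existsP.
have [c cP] := fin_all_exists exc; exists c; split=> [j|j j' eq_j].
  by case/andP: (cP j).
have /andP[_ /eqP lj] := cP j; have /andP[_ /eqP lj'] := cP j'.
move: eq_j; rewrite lj lj' => /val_inj/enum_val_inj/(congr1 val) /=.
exact: val_inj.
Qed.

(** * Counting exponent vectors in boxes *)

Lemma card_family_const (T : finType) (s a b : nat) (A E : {set 'I_s})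
    (F : 'I_s -> pred T) :
    [disjoint A & E] -> (forall i, i \in A -> #|F i| = a) ->
    (forall i, i \in E -> #|F i| = 1%N) ->
    (forall i, i \notin A -> i \notin E -> #|F i| = b) ->
  #|family F| = (a ^ #|A| * b ^ (s - #|A| - #|E|))%N.
Proof.
move=> disAE FA FE Fb.
rewrite card_family foldrE big_image /= (bigID (mem A)) /=; congr (_ * _)%N.
  by rewrite (eq_bigr _ FA) prod_nat_const.
rewrite (bigID (mem E)) /= big1 ?mul1n => [|i /andP[_ /FE //]].
rewrite (eq_bigr (fun=> b)) => [|i /andP[iA iE]]; last exact: Fb.
rewrite (eq_bigl (mem (~: (A :|: E)))) => [|i]; last by rewrite !inE negb_or.
rewrite prod_nat_const; congr (_ ^ _)%N.
rewrite cardsCs setCK card_ord cardsU.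
by have /eqP -> : A :&: E == set0; rewrite ?setI_eq0 // cards0 subn0 subnDA.
Qed.

Section Count.
Local Open Scope nat_scope.

Lemma card_box_support (s n : nat) (A E : {set 'I_s}) :
    [disjoint A & E] ->
  #|[set m : {ffun 'I_s -> 'I_n.+1} |
      [forall i, (i \in A) ==> (m i != ord0)] &&
      [forall i, (i \in E) ==> (m i == ord0)]]|
  = n ^ #|A| * n.+1 ^ (s - #|A| - #|E|).
Proof.
move=> disAE.
pose F i : pred 'I_n.+1 := [pred a | ((i \in A) ==> (a != ord0)) && ((i \in E) ==> (a == ord0))].
rewrite (eq_card (B := family F)) => [|m]; last first.
  rewrite inE; apply/andP/familyP => [[/forallP mA /forallP mE] i|mF].
    by rewrite inE mA mE.
  by split; apply/forallP => i; have := mF i; rewrite inE => /andP[].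
apply: card_family_const (disAE) _ _ _ => i iP.
- transitivity #|predC1 (ord0 : 'I_n.+1)|; last by rewrite cardC1 card_ord.
  by apply: eq_card => a; rewrite !inE iP (disjointFr disAE iP) andbT.
- rewrite -(card1 (ord0 : 'I_n.+1)).
  by apply: eq_card => a; rewrite !inE iP (disjointFl disAE iP).
- move=> iE; rewrite -[RHS]card_ord; apply: eq_card => a.
  by rewrite !inE (negPf iP) (negPf iE).
Qed.

(* For each [j] we only count the exponent vectors lying above [A j] and
   vanishing at one chosen element of [A i :\: A j] for every [i < j]; these
   families of vectors are pairwise disjoint. *)
Lemma card_upclosure_ge (s n d r : nat) (A : 'I_r -> {set 'I_s}) :
    injective A -> (forall j, #|A j| = d) -> 0 < d -> d + r <= s ->
  n ^ (d - 1) * n.+1 ^ (s - d - r + 1) * (n.+1 ^ r - 1) <=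
  #|[set m : {ffun 'I_s -> 'I_n.+1} |
      [exists j, [forall i, (i \in A j) ==> (m i != ord0)]]]|.
Proof.
move=> A_inj cardA d0 dr_le.
pose ltw (j : 'I_r) : 'I_j -> 'I_r := widen_ord (ltnW (ltn_ord j)).
(* Options spare a default element of ['I_s]. [None] never occurs, since distinct sets of equal size
   are not nested. *)
pose O (j : 'I_r) := [set [pick k in A (ltw j i) :\: A j] | i in 'I_j].
pose E j := [set k | Some k \in O j].
have cardE_le j : #|E j| <= j.
  rewrite -(card_imset _ (@Some_inj _)) -[leqRHS]card_ord.
  apply: leq_trans (leq_imset_card (fun i => [pick k in A (ltw j i) :\: A j]) _).
  by apply/subset_leq_card/subsetP => _ /imsetP[k kE ->]; rewrite inE in kE.
have disAE j : [disjoint A j & E j].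
  rewrite disjoint_sym disjoint_subset; apply/subsetP => k.
  rewrite inE => /imsetP[i _]; case: pickP => // k' /setDP[_ k'A] [->].
  by rewrite inE.
have E_meets (i j : 'I_r) : i < j -> exists2 k, k \in A i & k \in E j.
  move=> lt_ij; have defi : ltw j (Ordinal lt_ij) = i by apply: val_inj.
  have : [pick k in A i :\: A j] \in O j.
    by apply/imsetP; exists (Ordinal lt_ij); rewrite ?defi.
  case: pickP => [k /setDP[kA _] Ok|AD0 _]; first by exists k; rewrite // inE.
  have : A i \subset A j.
    by rewrite -setD_eq0; apply/eqP/setP => k; rewrite in_set0; apply: AD0.
  rewrite subEproper => /predU1P[/A_inj eq_ij|/proper_card].
    by move: (lt_ij); rewrite eq_ij ltnn.
  by rewrite !cardA ltnn.
pose B j := [set m : {ffun 'I_s -> 'I_n.+1} |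
      [forall i, (i \in A j) ==> (m i != ord0)] &&
      [forall i, (i \in E j) ==> (m i == ord0)]].
have disB_lt (i j : 'I_r) : i < j -> [disjoint B i & B j].
  move=> /E_meets[k kA kE]; rewrite disjoint_subset; apply/subsetP => m.
  rewrite !inE => /andP[/forallP/(_ k) mA _]; rewrite kA in mA.
  by rewrite negb_and orbC; apply/orP; left; apply/forallPn; exists k; rewrite kE.
have disB (i j : 'I_r) : i != j -> [disjoint B i & B j].
  rewrite -val_eqE neq_ltn => /orP[/disB_lt //|/disB_lt].
  by rewrite disjoint_sym.
apply: (@leq_trans #|(\bigcup_j B j) : {set _}|); last first.
  apply/subset_leq_card/bigcupsP => j _; apply/subsetP => m; rewrite !inE.
  by case/andP=> mA _; apply/existsP; exists j.
rewrite -sum1_card (partition_disjoint_bigcup _ _ disB).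
under eq_bigr => j _ do rewrite sum1_card card_box_support // cardA.
apply: (@leq_trans (\sum_(j < r) n ^ d * n.+1 ^ (s - d - j))); last first.
  by apply: leq_sum => j _; rewrite leq_mul2l leq_pexp2l ?orbT // leq_sub2l.
(* Geometric sum: (n+1)^r - 1 = n times the sum of (n+1)^i for i < r, read backwards. *)
rewrite (subn1 (_ ^ r)) predn_exp /= (reindex_inj rev_ord_inj) /=.
rewrite !big_distrr /= ; apply: eq_leq; apply: eq_bigr => j _.
have -> : n ^ d = n ^ (d - 1) * n by rewrite mulnC -expnS subn1 prednK.
have -> : s - d - j = (s - d - r + 1) + (r - j.+1).
  by have := ltn_ord j; lia.
by rewrite [in RHS]expnD mulnACA.
Qed.
End Count.

(** * The lower bound, from monomial multiples of the leading combinations *)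

Lemma ghw_lower_bound (K : finFieldType) (s d r n : nat)
    (H : 'I_r -> {mpoly K[s]}) :
    #|K| = n.+2 -> (0 < d)%N -> (d + r <= s)%N ->
    (forall i, inKV d (H i)) -> lin_indep H ->
  (n ^ (d - 1) * n.+1 ^ (s - d - r + 1) * (n.+1 ^ r - 1)
     <= #|torus K s :\: VT H|)%N.
Proof.
move=> Kn d0 dr_le HKV Hfree; have [c [nz c_inj]] := exists_mleads HKV Hfree.
pose h j := lincomb H (c j); pose A j := [set i | mlead (h j) i != 0%N].
have lead_sq j i : mlead (h j) i = (i \in A j) :> nat.
  have [/forallP/(_ i) + _] := msupp_lincomb HKV (mlead_supp (nz j)).
  by rewrite inE; case: (mlead _ i) => [|[]].
have A_inj : injective A.
  move=> j j' /setP eqA; apply: c_inj; apply/mnmP => i.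
  by rewrite /= !lead_sq eqA.
have cardA j : #|A j| = d.
  have [_ <-] := msupp_lincomb HKV (mlead_supp (nz j)).
  rewrite mdegE (eq_bigr _ (fun i _ => lead_sq j i)) -sum1_card big_mkcond /=.
  by apply: eq_bigr => i _; case: (i \in A j).
apply: leq_trans (card_upclosure_ge n A_inj cardA d0 dr_le) _.
set D := [set m | _].
have exP (m : {ffun 'I_s -> 'I_n.+1}) : exists p : {mpoly K[s]}, m \in D ->
    [/\ p != 0, mlead p = [multinom (m i : nat) | i < s]
      & forall x, x \in torus K s -> x \notin torus K s :\: VT H -> p.@[x] = 0].
  have [mD|] := boolP (m \in D); last by exists 0.
  have := mD; rewrite inE => /existsP[j /forallP Am].
  (* Multiplying [h j] by the quotient monomial [m'] moves its leading monomial to m and keeps its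
     zeros on V_T(H). *)
  pose m' := ([multinom (m i : nat) | i < s] - mlead (h j))%MM.
  exists ('X_[m'] * h j) => _; split.
  - rewrite mulf_neq0 ?nz //; apply/eqP => /(congr1 (mcoeff m')) /eqP.
    by rewrite mcoeffX eqxx mcoeff0 oner_eq0.
  - rewrite mleadM ?mleadXm ?nz ?submK //.
      apply/mnm_lepP => i; rewrite mnmE lead_sq.
      by have := Am i; case: (i \in A j); rewrite ?lt0n.
    apply/eqP => /(congr1 (mcoeff m')) /eqP.
    by rewrite mcoeffX eqxx mcoeff0 oner_eq0.
  - move=> x xT; rewrite inE xT andbT negbK inE xT /= => /forallP Hx.
    rewrite mevalM /h raddf_sum /= big1 ?mulr0 // => i _.
    by rewrite mevalZ (eqP (Hx i)) mulr0.
have [P PD] := fin_all_exists exP.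
apply: (card_mlead_le (P := P)) => [m|m m'|m|m] mD.
- by have [] := PD m mD.
- move=> m'D; have [_ -> _] := PD m mD; have [_ -> _] := PD m' m'D.
  move=> eqm; apply/ffunP => i; apply: val_inj.
  by have := congr1 (fun a : 'X_{1..s} => a i) eqm; rewrite !mnmE.
- by move=> i; have [_ -> _] := PD m mD; rewrite mnmE Kn.
- by have [] := PD m mD.
Qed.

(** * Index intervals and square-free forms *)

Lemma card_ord_interval (s lo hi : nat) :
  (hi <= s)%N -> #|[set i : 'I_s | lo <= i < hi]%N| = (hi - lo)%N.
Proof.
move=> hi_s; rewrite -sum1_card (eq_bigl (fun i : 'I_s => lo <= i < hi)%N); last first.
  by move=> i; rewrite inE.
rewrite -(big_mkord (fun i => lo <= i < hi)%N (fun=> 1%N)).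
rewrite -big_nat_widen // -(big_nat_widenl lo 0 hi predT) //.
by rewrite sum_nat_const_nat muln1.
Qed.

Lemma inKV_of_msupp (K : finFieldType) (s d : nat) (f : {mpoly K[s]}) :
  (forall m, m \in msupp f -> sqfree_mnm m /\ mdeg m = d) -> inKV d f.
Proof.
move=> fP; exists (fun m => f@_m).
rewrite {1}(@mpolywE _ _ d.+1 f); last first.
  by rewrite msizeE; apply/bigmax_leqP_seq => m /fP[_ ->].
rewrite [RHS]big_mkcond /=; apply: eq_bigr => m _; case: ifP => // nm.
rewrite memN_msupp_eq0 ?scale0r //; apply: contraFN nm => /fP[-> ->].
by rewrite eqxx.
Qed.

(** The set [A] of allowed variables is recorded because a product stays square-free when its
    factors use disjoint variables. *)
Definition sqfree_on (R : nzRingType) (s d : nat) (A : {set 'I_s})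
    (f : {mpoly R[s]}) :=
  forall m, m \in msupp f ->
    [/\ sqfree_mnm m, mdeg m = d & forall i, i \notin A -> m i = 0%N].

Lemma sqfree_onM (R : nzRingType) (s d e : nat) (A B : {set 'I_s})
    (f g : {mpoly R[s]}) :
    [disjoint A & B] -> sqfree_on d A f -> sqfree_on e B g ->
  sqfree_on (d + e) (A :|: B) (f * g).
Proof.
move=> disAB fP gP m /msuppM_le/allpairsP[[m1 m2] /= [/fP[sq1 d1 z1] /gP[sq2 d2 z2] ->]].
split=> [||i].
- apply/forallP => i; rewrite mnmDE.
  have [iA|iA] := boolP (i \in A); last by rewrite z1 // (forallP sq2).
  by rewrite z2 ?addn0 ?(forallP sq1) // (disjointFr disAB).
- by rewrite mdegD d1 d2.
- by rewrite inE negb_or => /andP[iA iB]; rewrite mnmDE z1 ?z2.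
Qed.

Lemma sqfree_onXB (R : nzRingType) (s : nat) (i j : 'I_s) :
  sqfree_on 1 [set i; j] ('X_i - 'X_j : {mpoly R[s]}).
Proof.
move=> m /msuppB_le; rewrite mem_cat !msuppX !inE => m_ij.
have [k -> k_ij] : exists2 k, m = U_(k)%MM & k \in [set i; j].
  by case/orP: m_ij => /eqP ->; [exists i | exists j]; rewrite // !inE eqxx ?orbT.
split=> [||l l_ij]; rewrite ?mdeg1 //; first by apply/forallP => l; rewrite mnm1E leq_b1.
by rewrite mnm1E; case: eqP l_ij k_ij => // -> /negPf ->.
Qed.

(** * The family attaining the bound, with d = e + 1 *)

Section Extremal.

Variables (K : finFieldType) (s e r : nat).
Hypothesis hs : (2 * e + r < s.+1)%N.

(** [inord] sends an index out of range to 0; [hs] keeps the indices in use, 0 to 2e + r, in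
    range. *)
Let id0 k : 'I_s.+1 := inord k.

Definition diff_prod k : {mpoly K[s.+1]} :=
  \prod_(i < k) ('X_(id0 i) - 'X_(id0 (e + i))).

Definition ext_family (j : 'I_r) : {mpoly K[s.+1]} :=
  diff_prod e * ('X_(id0 (2 * e + j.+1)) - 'X_(id0 (2 * e))).

Lemma sqfree_on_diff_prod k : (k <= e)%N ->
  sqfree_on k [set i : 'I_s.+1 | (i < k) || (e <= i < e + k)]%N (diff_prod k).
Proof.
elim: k => [|k IHk] lt_ke.
  rewrite /diff_prod big_ord0 => m; rewrite msupp1 inE => /eqP ->.
  by split=> [||i _]; rewrite ?mdeg0 ?mnm0E //; apply/forallP => i; rewrite mnm0E.
rewrite /diff_prod big_ord_recr /= -/(diff_prod k) -[k.+1]addn1.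
have id0E (i : nat) : (i < 2 * e)%N -> id0 i = i :> nat by move=> ?; rewrite inordK //; lia.
have -> : [set i : 'I_s.+1 | (i < k + 1) || (e <= i < e + (k + 1))]%N =
   [set i : 'I_s.+1 | (i < k) || (e <= i < e + k)]%N :|: [set id0 k; id0 (e + k)].
  apply/setP => i; rewrite !inE -!val_eqE /= !id0E; lia.
apply: sqfree_onM; [|by apply: IHk; lia|exact: sqfree_onXB].
rewrite disjoint_sym disjoint_subset; apply/subsetP => i.
by rewrite !inE -!val_eqE /= !id0E; lia.
Qed.

Lemma ext_family_inKV j : inKV e.+1 (ext_family j).
Proof.
apply: inKV_of_msupp => m.
have /(_ m) : sqfree_on (e + 1) ([set i : 'I_s.+1 | (i < e) || (e <= i < e + e)]%N
    :|: [set id0 (2 * e + j.+1); id0 (2 * e)]) (ext_family j).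
  apply: sqfree_onM; [|exact: sqfree_on_diff_prod|exact: sqfree_onXB].
  have := ltn_ord j.
  rewrite disjoint_sym disjoint_subset => lt_j; apply/subsetP => i.
  by rewrite !inE -!val_eqE /= !inordK; lia.
by move=> mP /mP[? ? _]; rewrite -[e.+1]addn1.
Qed.

Lemma ext_family_eval j (x : 'I_s.+1 -> K) :
  (ext_family j).@[x] = (\prod_(i < e) (x (id0 i) - x (id0 (e + i))))
     * (x (id0 (2 * e + j.+1)) - x (id0 (2 * e))).
Proof.
rewrite mevalM mevalB !mevalXU rmorph_prod /=; congr (_ * _).
by apply: eq_bigr => i _; rewrite mevalB !mevalXU.
Qed.

(** Evaluation at a 0/1 point, which lies outside the torus, isolates one form: there every common
    factor is 1 and the last factor is 1 for [j0], 0 for the others. *)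
Lemma ext_family_indep : lin_indep ext_family.
Proof.
move=> c sum0 j0.
pose x (i : 'I_s.+1) : K := ((i < e) || (i == 2 * e + j0.+1 :> nat))%N%:R.
have Hx j : (ext_family j).@[x] = (j == j0)%:R.
  have := ltn_ord j; have := ltn_ord j0 => lt_j0 lt_j.
  rewrite ext_family_eval big1 => [|i _]; last first.
    have := ltn_ord i => lt_i; rewrite /x !inordK; try lia.
    by rewrite lt_i [in X in _ - X](_ : _ || _ = false) ?subr0 //; lia.
  rewrite mul1r /x !inordK; try lia.
  rewrite [in X in _ - X](_ : _ || _ = false) ?subr0; last by lia.
  by congr (_%:R : K); rewrite -val_eqE /=; lia.
have := congr1 (meval x) sum0; rewrite meval0 raddf_sum /= (bigD1 j0) //=.
rewrite big1 => [|j ne_j]; last by rewrite mevalZ Hx (negPf ne_j) mulr0.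
by rewrite mevalZ Hx eqxx mulr1 addr0.
Qed.

(* Dividing each coordinate by its partner in the linear factors turns
   [x i != x j] into [y i != 1], so that the points to be counted are mapped
   injectively into the difference of two boxes. *)
Lemma card_ext_family_le (n : nat) : #|K| = n.+2 ->
  (#|torus K s.+1 :\: VT ext_family|
     <= n ^ e * n.+1 ^ (s.+1 - e - r) * (n.+1 ^ r - 1))%N.
Proof.
move=> Kn; set N := _ :\: _.
(* [p i] is the partner of i in the linear factors; a coordinate that is nobody's first term is its
   own partner. Coordinates fixed by [p] are unchanged by [phi], which makes [phi] injective on the
   torus. *)
pose p (i : 'I_s.+1) : 'I_s.+1 :=
  if (i < e)%N then id0 (e + i) else
  if (2 * e < i <= 2 * e + r)%N then id0 (2 * e) else i.
have p_lt (i : 'I_s.+1) : (i < e)%N -> p i = id0 (e + i) by rewrite /p => ->.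
have p_mid (i : 'I_s.+1) : (2 * e < i <= 2 * e + r)%N -> p i = id0 (2 * e).
  by move=> mid_i; rewrite /p mid_i ifN //; lia.
have p_root (i : 'I_s.+1) : (e <= i <= 2 * e)%N -> p i = i.
  by move=> root_i; rewrite /p !ifN //; lia.
have pp i : p (p i) = p i.
  have [lt_i|ge_i] := ltnP i e.
    by rewrite (p_lt _ lt_i) p_root // inordK; lia.
  have [mid_i|Ni] := boolP (2 * e < i <= 2 * e + r)%N.
    by rewrite (p_mid _ mid_i) p_root // inordK; lia.
  have pi : p i = i by rewrite /p !ifN //; lia.
  by rewrite pi.
pose phi (x : {ffun 'I_s.+1 -> K}) : {ffun 'I_s.+1 -> K} :=
  [ffun i => if p i == i then x i else x i / x (p i)].
have phi_inj : {in N &, injective phi}.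
  move=> x y; rewrite !inE => /andP[_ /forallP x0] /andP[_ /forallP y0] /ffunP eq_phi.
  have eq_root i : p i = i -> x i = y i.
    by move=> pi; have := eq_phi i; rewrite !ffunE pi eqxx.
  apply/ffunP => i; have := eq_phi i; rewrite !ffunE; case: eqP => // _.
  by rewrite (eq_root (p i)) ?pp //; apply: mulIf; rewrite invr_eq0.
pose A : {set 'I_s.+1} := [set i : 'I_s.+1 | 0 <= i < e]%N.
pose E : {set 'I_s.+1} := [set i : 'I_s.+1 | 2 * e + 1 <= i < 2 * e + 1 + r]%N.
have inA i : (i \in A) = (i < e)%N by rewrite inE.
have inE_ i : (i \in E) = (2 * e < i <= 2 * e + r)%N by rewrite inE; lia.
have cardA : #|A| = e by rewrite card_ord_interval ?subn0 //; lia.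
have cardE : #|E| = r by rewrite card_ord_interval //; lia.
clearbody A E.
have disAE : [disjoint A & E].
  by rewrite disjoint_subset; apply/subsetP => i; rewrite inE inA inE_; lia.
(* In the box [F] the first e coordinates differ from 1; [G] is the part where moreover the r
   coordinates in [E] equal 1, that is, where every last factor vanishes. *)
pose F (i : 'I_s.+1) : pred K :=
  [pred y | (y != 0) && ((i \in A) ==> (y != 1))].
pose G (i : 'I_s.+1) : pred K :=
  [pred y | F i y && ((i \in E) ==> (y == 1))].
have card_neq0 : #|[pred y : K | y != 0]| = n.+1 by rewrite card_finField_neq0 Kn.
have FA i : i \in A -> #|F i| = n.
  move=> iA; have := cardD1 1 [pred y : K | y != 0].
  rewrite card_neq0 inE oner_eq0 => -[->].
  by apply: eq_card => y; rewrite !inE iA andbC.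
have Fb i : i \notin A -> #|F i| = n.+1.
  move=> iA; rewrite -card_neq0; apply: eq_card => y.
  by rewrite !inE (negPf iA) andbT.
have cardF : #|family F| = (n ^ e * n.+1 ^ (s.+1 - e))%N.
  have dis0 : [disjoint A & (set0 : {set 'I_s.+1})] by rewrite -setI_eq0 setI0.
  rewrite (card_family_const dis0 FA (b := n.+1)) => [|i|i /Fb //].
    by rewrite cardA cards0 subn0.
  by rewrite inE.
have cardG : #|family G| = (n ^ e * n.+1 ^ (s.+1 - e - r))%N.
  rewrite (card_family_const (a := n) (b := n.+1) disAE) => [|i|i|i].
  - by rewrite cardA cardE.
  - move=> iA; rewrite -(FA i iA); apply: eq_card => y.
    by rewrite !inE (disjointFr disAE iA) andbT.
  - move=> iE; rewrite -(card1 (1 : K)); apply: eq_card => y.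
    rewrite !inE /F /= iE (disjointFl disAE iE) /= andbT.
    by case: (y =P 1) => [->|_]; rewrite ?oner_eq0 ?andbF.
  - move=> iA iE; rewrite -(Fb i iA); apply: eq_card => y.
    by rewrite !inE (negPf iE) andbT.
rewrite -(card_in_imset phi_inj).
have subFG : phi @: N \subset [predD family F & family G].
  apply/subsetP => _ /imsetP[x xN ->]; move: xN; rewrite !inE => /andP[nV xT].
  rewrite xT /= in nV; move/forallP: xT => x0; case/forallPn: nV => j.
  rewrite ext_family_eval mulf_eq0 negb_or subr_eq0 => /andP[prod_neq0 ne_j].
  have lt_j := ltn_ord j.
  apply/andP; split.
    apply/familyP => /(_ (id0 (2 * e + j.+1))).
    have -> : phi x (id0 (2 * e + j.+1)) = x (id0 (2 * e + j.+1)) / x (id0 (2 * e)).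
      rewrite ffunE p_mid; last by rewrite inordK; lia.
      by rewrite -val_eqE /= !inordK; try lia; case: eqP => //; lia.
    rewrite inE => /andP[_]; rewrite inE_ [X in X ==> _](_ : _ = true).
      by move=> /eqP eq1; rewrite -[X in X == _](divfK (x0 (id0 (2 * e)))) eq1 mul1r eqxx in ne_j.
    by rewrite inordK; lia.
  apply/familyP => i; rewrite !inE ffunE; apply/andP; split.
    by case: ifP => _ //; rewrite mulf_neq0 ?invr_eq0.
  apply/implyP; rewrite inA => lt_i; move/prodf_neq0: prod_neq0 => /(_ (Ordinal lt_i) isT) /=.
  rewrite subr_eq0 (p_lt _ lt_i) (inord_val i : id0 i = i) ifN.
    apply: contraNN => /eqP eq1.
    by rewrite -[X in X == _](divfK (x0 (id0 (e + i)))) eq1 mul1r.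
  by rewrite -val_eqE /= inordK; lia.
apply: leq_trans (subset_leq_card subFG) _.
rewrite leq_eqVlt; apply/orP; left.
have sGF : {subset family G <= family F}.
  move=> y /familyP Gy; apply/familyP => i.
  by have := Gy i; rewrite !inE => /andP[].
have <- : (#|family F| - #|family G| = #|[predD family F & family G]|)%N.
  rewrite -(cardID (family G) (family F)).
  rewrite (eq_card (A := [predI _ & _]) (B := family G)) ?addKn // => y.
  by rewrite !inE; apply: andb_idl => /sGF.
rewrite cardF cardG mulnBr muln1; apply/eqP; congr (_ - _)%N.
by rewrite -mulnA -expnD subnK //; lia.
Qed.

End Extremal.

Theorem corollary4p2 (K : finFieldType) (s d r : nat)
    (hs : (2 <= s)%N) (hd1 : (1 <= d)%N) (hds : (d <= s)%N)
    (hr1 : (1 <= r)%N) (hrs : (r <= 'C(s, d))%N)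
    (hsdr : (2 * d + r - 2 < s)%N) :
  is_ghw K s d r
    ((#|K| - 2) ^ (d - 1) * (#|K| - 1) ^ (s - d - r + 1)
       * ((#|K| - 1) ^ r - 1))%N.
Proof.
have [n Kn] : exists n, #|K| = n.+2.
  by case: #|K| (card_finField_gt1 K) => [|[|n]] // _; exists n.
have -> : (#|K| - 2 = n)%N by rewrite Kn subn2.
have -> : (#|K| - 1 = n.+1)%N by rewrite Kn subn1.
have dr_le : (d + r <= s)%N by lia.
split=> [|H HKV Hfree]; last exact: ghw_lower_bound.
case: s d hs hd1 hds hrs hsdr dr_le => // s [//|e] _ _ _ _ hsdr dr_le.
have hs : (2 * e + r < s.+1)%N by lia.
have HKV := ext_family_inKV K hs; have Hfree := ext_family_indep hs (K := K).
(* The count for this family gives one inequality; the general lower bound, applied to it, gives the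
   other. *)
exists (@ext_family K s e r); split=> //; apply/eqP; rewrite eqn_leq.
rewrite (ghw_lower_bound Kn _ _ HKV Hfree) // andbT.
have -> : (s.+1 - e.+1 - r + 1 = s.+1 - e - r)%N by lia.
by rewrite subn1 /=; apply: card_ext_family_le.
Qed.
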